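(* Let $d\ge 1$, $(g,\mu)\in[0,+\infty)^2$, $T>0$, and let $h\in C^\infty([0,T]\times\mathbf{T}^d)$ be a smooth positive solution to $$\partial_t h-\operatorname{div}\big(gh\nabla h-\mu h\nabla\Delta h\big)=0 .$$ Then, for all $t\in[0,T]$, $$\frac{d}{dt}\int_{\mathbf{T}^d}h^2\,dx\le 0\qquad\text{and}\qquad\frac{d}{dt}\int_{\mathbf{T}^d}|\nabla h|^2\,dx\le 0 .$$
   Context: $\mathbf{T}^d$ is a $d$-dimensional (flat) torus; $\nabla$, $\operatorname{div}$, $\Delta$ are taken with respect to $x\in\mathbf{T}^d$. *)

(* Defs.v *)
From HB Require Import structures.
From mathcomp Require Import all_boot all_order all_algebra.
From mathcomp Require Import all_classical all_reals all_analysis.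

Set Implicit Arguments.
Unset Strict Implicit.
Unset Printing Implicit Defensive.

Import Order.TTheory GRing.Theory Num.Theory.
Import numFieldNormedType.Exports.

Local Open Scope classical_set_scope.
Local Open Scope ring_scope.

(* Derivative at t of f restricted to A: at an interior point of A this is the
   usual derivative, at an endpoint of an interval the one-sided one. *)
Definition quotient_within {R : realType} (f : R -> R) (t : R) : R -> R :=
  fun s => (s - t)^-1 * (f s - f t).

Definition derivable_within {R : realType} (A : set R) (f : R -> R) (t : R) :
    Prop :=
  cvg (quotient_within f t @ within A t^').

Definition derive_within {R : realType} (A : set R) (f : R -> R) (t : R) : R :=
  lim (quotient_within f t @ within A t^').

Section space_operators.
Context {R : realType} {d : nat}.

Definition partial (i : 'I_d) (f : 'rV[R]_d -> R) : 'rV[R]_d -> R :=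
  'D_(delta_mx 0 i) f.

Definition grad (f : 'rV[R]_d -> R) : 'rV[R]_d -> 'rV[R]_d :=
  fun x => \row_i partial i f x.

Definition div (V : 'rV[R]_d -> 'rV[R]_d) : 'rV[R]_d -> R :=
  fun x => \sum_(i < d) partial i (fun y => V y 0 i) x.

Definition laplacian (f : 'rV[R]_d -> R) : 'rV[R]_d -> R := div (grad f).

(* The library norm on 'rV[R]_d is the sup norm, hence this definition. *)
Definition sqnorm (v : 'rV[R]_d) : R := \sum_(i < d) v 0 i ^+ 2.

End space_operators.

(* A flat torus is the quotient of R^d by the lattice generated by the rows of
   an invertible matrix P; functions on it are the functions on R^d that are
   invariant under these rows. *)
Definition lattice_periodic {R : realType} {d : nat} (P : 'M[R]_d)
    (f : 'rV[R]_d -> R) : Prop :=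
  forall (i : 'I_d) (x : 'rV[R]_d), f (x + row i P) = f x.

(* Integral over the unit cube [0,1]^n as an iterated Lebesgue integral. *)
Fixpoint cube_integral {R : realType} (n : nat) : ('rV[R]_n -> R) -> R :=
  match n with
  | 0%N => fun f => f 0
  | m.+1 => fun f =>
      \int[@lebesgue_measure R]_(s in `[0, 1])
        cube_integral (fun v : 'rV[R]_m =>
          f (row_mx (const_mx s : 'rV[R]_1) v))
  end.

(* Integral over the fundamental cell { u *m P | u in [0,1]^d }, which has
   volume `|\det P|. *)
Definition torus_integral {R : realType} {d : nat} (P : 'M[R]_d)
    (f : 'rV[R]_d -> R) : R :=
  `|\det P| * cube_integral (fun u => f (u *m P)).

Section smoothness.
Context {R : realType} {d : nat} (T : R).

Definition dtime (f : R -> 'rV[R]_d -> R) : R -> 'rV[R]_d -> R :=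
  fun t x => derive_within `[0, T] (f^~ x) t.

Definition dspace (i : 'I_d) (f : R -> 'rV[R]_d -> R) : R -> 'rV[R]_d -> R :=
  fun t => partial i (f t).

(* f is C^k on [0,T] x R^d: all iterated partial derivatives of order at most k
   (in any order of differentiation, one-sided in time at t = 0 and t = T) exist
   and are jointly continuous there. *)
Fixpoint Ck (k : nat) (f : R -> 'rV[R]_d -> R) : Prop :=
  {within `[0, T] `*` [set: 'rV[R]_d],
    continuous (fun p : R * 'rV[R]_d => f p.1 p.2)} /\
  match k with
  | 0%N => True
  | m.+1 =>
      [/\ forall (t : R) (x : 'rV[R]_d), t \in `[0, T] ->
            derivable_within `[0, T] (f^~ x) t,
          forall (i : 'I_d) (t : R) (x : 'rV[R]_d), t \in `[0, T] ->
            derivable (f t) x (delta_mx 0 i),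
          Ck m (dtime f) &
          forall i : 'I_d, Ck m (dspace i f)]
  end.

Definition smooth (f : R -> 'rV[R]_d -> R) : Prop := forall k, Ck k f.

End smoothness.

(* Main.v *)
(** Write [J] for the integral over the torus, [L] for the Laplacian of [h], and
    subscripts for partial derivatives. Integrating the equation against [h] and
    against [-L] gives
      [J (h h_t) = - g J (h |grad h|^2) - mu X] and
      [- J (L h_t) = - g X - mu J (h |grad L|^2)],
    where [X = J (L div (h grad h))]. Two integrations by parts show
    [3 X = J (h L^2) + 2 \sum_ij J (h h_ij^2)], which is nonnegative.

    The energies are differentiated from
      [J (h(s)^2) - J (h(t)^2) = J ((h(s) - h(t)) (h(s) + h(t)))] and
      [J |grad h(s)|^2 - J |grad h(t)|^2 = - J ((h(s) - h(t)) (L(s) + L(t)))],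
    so that no exchange of time and space derivatives is needed: difference
    quotients converge uniformly on the compact cell. Integration by parts on the
    torus follows in the same way from the translation invariance of [J] on
    periodic functions, by differentiating [J (f (s e_i + x))] at [s = 0]. *)

Require Import Defs.
From mathcomp Require Import all_boot all_order all_algebra.
From mathcomp Require Import ring lra.
From mathcomp Require Import all_classical all_reals all_analysis.

Set Implicit Arguments.
Unset Strict Implicit.
Unset Printing Implicit Defensive.

Import Order.TTheory GRing.Theory Num.Theory.
Import numFieldNormedType.Exports.

Local Open Scope classical_set_scope.
Local Open Scope ring_scope.

(** * Periodic functions of one real variable *)

Section one_dimension.
Context {R : realType}.
Local Notation mu := (@lebesgue_measure R).

Lemma continuous_itv_integrable (f : R -> R) (a b : R) : continuous f ->
  mu.-integrable `[a, b] (EFin \o f).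
Proof.
move=> cf; apply: continuous_compact_integrable; first exact: segment_compact.
exact: continuous_subspaceT.
Qed.

Lemma derivable1_continuous (f : R -> R) (x : R) :
  derivable f x 1 -> {for x, continuous f}.
Proof. by move/derivable1_diffP/differentiable_continuous. Qed.

(* Both sides are values of [w |-> K (1 + w) - K w] for an antiderivative [K]
   of [G], and periodicity makes the derivative of that map vanish. *)
Lemma periodic_Rintegral_translate (G : R -> R) (w : R) :
  continuous G -> (forall s, G (s + 1) = G s) ->
  \int[mu]_(s in `[0, 1]) G (s + w) = \int[mu]_(s in `[0, 1]) G s.
Proof.
move=> cG pG.
(* This [a] lies strictly below both [0] and [w], so the antiderivative [K] based at [a] is
   differentiable wherever it is evaluated below. *)
pose a : R := - (`|w| + 1).
have aw : a < w.
  by rewrite /a ltrNl (le_lt_trans (ler_norm (- w)))// normrN ltrDl.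
have a0 : a < 0 by rewrite /a oppr_lt0 ltr_wpDl.
pose K (x : R) : R := \int[mu]_(t in `[a, x]) G t.
have dK x : a < x -> is_derive x 1 K (G x).
  move=> ax; have xu : x < x + 1 by rewrite ltrDl.
  have [] := @continuous_FTC1_closed R G a x (x + 1) xu
    (continuous_itv_integrable a (x + 1) cG) ax (cG x).
  by move=> dF; rewrite derive1E => FE; exact: DeriveDef.
have shiftK c x : a < x + c -> is_derive x 1 (fun s => K (s + c)) (G (x + c)).
  move=> axc.
  have -> : (fun s => K (s + c)) = K \o shift c by [].
  have dxc := dK _ axc.
  have dsh : is_derive x 1 (shift c) (1 : R) by exact: is_derive_shift.
  by have := @is_derive1_comp _ K (shift c) _ _ _ dxc dsh; rewrite mulr1.
have FTC c : a < c -> \int[mu]_(s in `[0, 1]) G (s + c) = K (1 + c) - K c.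
  move=> ac.
  have d (x : R) : 0 <= x -> is_derive x 1 (fun s => K (s + c)) (G (x + c)).
    by move=> x0; apply: shiftK; rewrite (lt_le_trans ac)// lerDr.
  have cK (x : R) : 0 <= x -> {for x, continuous (fun s => K (s + c))}.
    by move=> x0; apply: derivable1_continuous; have [] := d _ x0.
  rewrite /Rintegral (@continuous_FTC2 _ _ (fun s => K (s + c)))//.
  - by rewrite /= add0r.
  - apply: continuous_subspaceT => x; apply: continuous_comp; last exact: cG.
    by apply: cvgD; [exact: cvg_id|exact: cvg_cst].
  - split => [x||].
    + by rewrite in_itv/= => /andP[/ltW x0 _]; have [] := d _ x0.
    + by apply: cvg_at_right_filter; exact: cK.
    + by apply: cvg_at_left_filter; exact: cK.
  - move=> x; rewrite in_itv/= => /andP[/ltW x0 _].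
    by rewrite derive1E; have [] := d _ x0.
(* The right-hand integral is read as the translate by [0], so that [FTC] evaluates both sides. *)
rewrite FTC//; under [RHS]eq_Rintegral do rewrite -[X in G X]addr0.
rewrite FTC//.
pose D (x : R) : R := K (x + 1) - K (x + 0).
have dD (x : R) : a < x -> is_derive x 1 D 0.
  move=> ax; have h1 : is_derive x 1 (fun s => K (s + 1)) (G (x + 1)).
    by apply: shiftK; rewrite (lt_trans ax)// ltrDl.
  have h0 : is_derive x 1 (fun s => K (s + 0)) (G (x + 0)).
    by apply: shiftK; rewrite addr0.
  by have := is_deriveB h1 h0; rewrite pG addr0 subrr.
suff : D w = D 0 by rewrite /D !addr0 !(addrC _ 1) addr0.
have cst (x y : R) : a < x -> x <= y -> D y = D x.
  move=> ax xy; apply/subr0_eq.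
  have [| |c _ ->] := @MVT_segment _ D (cst 0) _ _ xy.
  - move=> z; rewrite in_itv/= => /andP[xz _]; apply: dD; exact: lt_trans xz.
  - apply: derivable_within_continuous => z; rewrite in_itv/= => /andP[xz _].
    by have [] := dD _ (lt_le_trans ax xz).
  - by rewrite mul0r.
by have [/cst->//|/ltW/cst->//] := leP 0 w.
Qed.

End one_dimension.

(** * The iterated integral over the unit cube: linearity, positivity, limits, translations *)

Section cube_integral.
Context {R : realType}.
Local Notation mu := (@lebesgue_measure R).
Local Notation C := cube_integral.

Lemma continuous_add (T : topologicalType) (f g : T -> R) :
  continuous f -> continuous g -> continuous (fun x => f x + g x).
Proof. by move=> cf cg x; apply: cvgD; [exact: cf|exact: cg]. Qed.

Lemma continuous_mul (T : topologicalType) (f g : T -> R) :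
  continuous f -> continuous g -> continuous (fun x => f x * g x).
Proof. by move=> cf cg x; apply: cvgM; [exact: cf|exact: cg]. Qed.

(** A neighbourhood of a row vector contains a product of neighbourhoods of its entries, and
    finitely many eventual conditions hold simultaneously. *)
Lemma cvg_rV (T : Type) (F : set_system T) {FF : Filter F} (n : nat)
    (g : T -> 'rV[R]_n) (y : 'rV[R]_n) :
  (forall j, g s 0 j @[s --> F] --> y 0 j) -> g @ F --> y.
Proof.
move=> gy A [P yP PA].
suff : \forall s \near F, forall ij : 'I_1 * 'I_n, P ij.1 ij.2 (g s ij.1 ij.2).
  by apply: filterS => s Ps; apply: PA => i j; exact: (Ps (i, j)).
apply: filter_forall => -[i j] /=; rewrite (ord1 i).
by apply: (gy j (P 0 j)); rewrite -(ord1 i); exact: yP.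
Qed.

Lemma cvg_row_mx (T : Type) (F : set_system T) {FF : Filter F} (n : nat)
    (a : T -> R) (g : T -> 'rV[R]_n) (a0 : R) (y : 'rV[R]_n) :
  a @ F --> a0 -> g @ F --> y ->
  row_mx (const_mx (a s) : 'rV_1) (g s) @[s --> F] -->
    row_mx (const_mx a0 : 'rV_1) y.
Proof.
move=> aa0 gy; apply: cvg_rV => j; case: (split_ordP j) => k ->.
  rewrite row_mxEl mxE; under eq_cvg do rewrite row_mxEl mxE.
  exact: aa0.
rewrite row_mxEr; under eq_cvg do rewrite row_mxEr.
apply: (cvg_comp g (fun M : 'rV[R]_n => M 0 k) gy).
exact: (@coord_continuous _ _ _ 0 k y).
Qed.

Lemma mulmx_continuous (m n : nat) (P : 'M[R]_(m, n)) :
  continuous (fun u : 'rV[R]_m => u *m P).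
Proof.
move=> u; apply: (@cvg_rV _ (nbhs u) _) => j.
rewrite mxE; under eq_cvg do rewrite mxE.
apply: cvg_big => [|i _]; first exact: add_continuous.
by apply: cvgMr_tmp; exact: coord_continuous.
Qed.

Definition unit_cube (n : nat) : set 'rV[R]_n :=
  [set u | forall j, `[0, 1]%classic (u 0 j)].

Lemma compact_unit_cube (n : nat) : compact (@unit_cube n).
Proof.
apply: (@rV_compact R n (fun=> `[0, 1]%classic)) => _; exact: segment_compact.
Qed.

(** These three properties suffice to pass to the limit under [I]. They are isolated so that the
    induction on the dimension can use limits in dimension [n] before linearity is known in
    dimension [n.+1]. *)
Definition normalized_mean (n : nat) (I : ('rV[R]_n -> R) -> R) : Prop :=
  [/\ forall (a : R) (f g : 'rV[R]_n -> R), continuous f -> continuous g ->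
        I (fun u => a * f u + g u) = a * I f + I g,
      forall f : 'rV[R]_n -> R, continuous f ->
        (forall u, @unit_cube n u -> 0 <= f u) -> 0 <= I f &
      I (fun=> 1) = 1].

(** Convergence is assumed jointly in the point and the parameter; compactness of the cube turns it
    into uniform convergence there. Linearity, positivity and [I 1 = 1] then bound [I k - I (Phi s)]
    by the uniform error. *)
Lemma normalized_mean_cvg (n : nat) (I : ('rV[R]_n -> R) -> R) (X : Type)
    (F : set_system X) {FF : Filter F} (Phi : X -> 'rV[R]_n -> R)
    (k : 'rV[R]_n -> R) :
  normalized_mean I ->
  (\forall s \near F, continuous (Phi s)) -> continuous k ->
  (forall u, @unit_cube n u ->
    Phi p.2 p.1 @[p --> filter_prod (nbhs u) F] --> k u) ->
  I (Phi s) @[s --> F] --> I k.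
Proof.
move=> [linI posI I1] cPhi ck Phik; apply/cvgrPdist_le => e e0.
have unif : \forall s \near F,
    @unit_cube n `<=` (fun u => `|k u - Phi s u| <= e).
  have /compact_near_coveringP/(_ X F (fun s u => `|k u - Phi s u| <= e)) :=
    @compact_unit_cube n.
  apply => u cu.
  have kk : k p.1 @[p --> filter_prod (nbhs u) F] --> k u.
    exact: (cvg_comp fst k cvg_fst (ck u)).
  have e20 : 0 < e / 2 by rewrite divr_gt0.
  have /cvgrPdist_le/(_ _ e20) h1 := Phik u cu.
  have /cvgrPdist_le/(_ _ e20) h2 := kk.
  near=> p => /=.
  have -> : k p.1 - Phi p.2 p.1 = (k u - Phi p.2 p.1) - (k u - k p.1) by ring.
  rewrite (le_trans (ler_normB _ _))// (splitr e).
  by apply: lerD; near: p; [exact: h1|exact: h2].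
near=> s.
have cPs : continuous (Phi s) by near: s.
have cc (a : R) : continuous (fun _ : 'rV[R]_n => a) by exact: cst_continuous.
have cdiff : continuous (fun u => (-1) * Phi s u + k u).
  by apply: continuous_add => //; exact: continuous_mul.
have us : @unit_cube n `<=` (fun u => `|k u - Phi s u| <= e) by near: s.
have diffE : I k - I (Phi s) = I (fun u => (-1) * Phi s u + k u).
  by rewrite linI// mulN1r addrC.
(* Linearity is available only for combinations [a * f + g], so [e] is written as [e * 1 + 0] and
   [0] as [(-1) * 1 + 1]. *)
have cste : I (fun=> e) = e.
  have -> : (fun _ : 'rV[R]_n => e) = (fun u => e * 1 + 0).
    by apply/funext => u; rewrite mulr1 addr0.
  rewrite linI// I1 mulr1.
  have -> : (fun _ : 'rV[R]_n => 0 : R) = (fun u => (-1) * 1 + 1).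
    by apply/funext => u; rewrite mulr1 addNr.
  by rewrite linI// I1 mulr1 addNr addr0.
rewrite diffE ler_norml; apply/andP; split.
  rewrite -subr_ge0 opprK -cste -[X in X + _]mul1r -linI//.
  apply: posI => [|u /us].
    by apply: continuous_add => //; exact: continuous_mul.
  by rewrite ler_norml => /andP[? ?]; lra.
rewrite -subr_ge0 -cste addrC -[X in X + _]mulN1r -linI//.
apply: posI => [|u /us].
  by apply: continuous_add => //; exact: continuous_mul.
by rewrite ler_norml => /andP[? ?]; lra.
Unshelve. all: by end_near. Qed.

Lemma row_mx_continuousr (n : nat) (f : 'rV[R]_n.+1 -> R) (s : R) :
  continuous f ->
  continuous (fun v : 'rV[R]_n => f (row_mx (const_mx s : 'rV_1) v)).
Proof.
move=> cf v.
apply: (cvg_comp (fun v => row_mx (const_mx s : 'rV_1) v) f _ (cf _)).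
exact: (@cvg_row_mx _ (nbhs v) _ _ _ _ _ _ (cvg_cst _) cvg_id).
Qed.

Lemma normalized_mean_continuous (n : nat) (I : ('rV[R]_n -> R) -> R)
    (f : 'rV[R]_n.+1 -> R) :
  normalized_mean I -> continuous f ->
  continuous (fun s : R => I (fun v => f (row_mx (const_mx s : 'rV_1) v))).
Proof.
move=> mI cf s; apply: (normalized_mean_cvg mI).
- by apply: nearW => r; exact: row_mx_continuousr.
- exact: row_mx_continuousr.
- move=> u _.
  apply: (cvg_comp (fun p => row_mx (const_mx p.2 : 'rV_1) p.1) f _ (cf _)).
  apply: (@cvg_row_mx _ _ _ _ snd fst).
    exact: cvg_snd.
  exact: cvg_fst.
Qed.

Lemma unit_cube_row_mx (n : nat) (s : R) (v : 'rV[R]_n) :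
  `[0, 1]%classic s -> @unit_cube n v ->
  @unit_cube (1 + n) (row_mx (const_mx s : 'rV_1) v).
Proof.
move=> s01 cv j; case: (@split_ordP 1 n j) => k ->.
  by rewrite row_mxEl mxE.
by rewrite row_mxEr.
Qed.

(** By induction on the dimension: the induction hypothesis makes the inner integral continuous in
    the first coordinate, hence integrable on [[0, 1]], as additivity of the outer integral
    requires. *)
Lemma cube_integral_mean (n : nat) : normalized_mean (@cube_integral R n).
Proof.
elim: n => [|n IH].
  by split => //= f _ f0; apply: f0 => -[].
have cI f : continuous f -> continuous (fun s : R =>
    C (fun v : 'rV_n => f (row_mx (const_mx s : 'rV_1) v))).
  exact: normalized_mean_continuous IH.
have [linI posI I1] := IH.
split => [a f g cf cg|f cf f0|] /=.
- under eq_Rintegral => s _.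
    rewrite linI; [over|exact: row_mx_continuousr|exact: row_mx_continuousr].
  rewrite RintegralD//.
  + by rewrite RintegralZl//; apply: continuous_itv_integrable; exact: cI.
  + apply: continuous_itv_integrable.
    by apply: continuous_mul; [exact: cst_continuous|exact: cI].
  + by apply: continuous_itv_integrable; exact: cI.
- apply: Rintegral_ge0 => s s01; apply: posI; first exact: row_mx_continuousr.
  by move=> u cu; apply: f0; exact: unit_cube_row_mx.
- rewrite I1 Rintegral_cst//= mul1r.
  by rewrite lebesgue_measure_itv/= lte_fin ltr01 oppr0 adde0.
Qed.

Lemma row_mx_add_deltal (n : nat) (s : R) (v : 'rV[R]_n) :
  row_mx (const_mx (s + 1) : 'rV_1) v =
    row_mx (const_mx s : 'rV_1) v + delta_mx 0 (lshift n 0).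
Proof.
apply/rowP => i; rewrite [RHS]mxE; case: (split_ordP i) => k ->.
  by rewrite !row_mxEl !mxE eq_lshift (ord1 k) eqxx.
by rewrite !row_mxEr !mxE eq_rlshift andbF addr0.
Qed.

Lemma row_mx_add_deltar (n : nat) (s : R) (v : 'rV[R]_n) (j : 'I_n) :
  row_mx (const_mx s : 'rV_1) (v + delta_mx 0 j) =
    row_mx (const_mx s : 'rV_1) v + delta_mx 0 (rshift 1 j).
Proof.
apply/rowP => i; rewrite [RHS]mxE; case: (split_ordP i) => k ->.
  by rewrite !row_mxEl !mxE eq_lrshift andbF addr0.
by rewrite !row_mxEr !mxE eq_rshift.
Qed.

(** The translation splits into its first coordinate [w0] and the remainder [w']. The inner integral
    absorbs [w'] by induction, and the outer one absorbs [w0] by the one-dimensional case. *)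
Lemma cube_integral_translate (n : nat) (F : 'rV[R]_n -> R) (w : 'rV[R]_n) :
  continuous F -> (forall j u, F (u + delta_mx 0 j) = F u) ->
  C (fun u => F (u + w)) = C F.
Proof.
elim: n F w => [|n IH] F w cF pF /=; first by rewrite (thinmx0 w) addr0.
pose G (s : R) := C (fun v : 'rV_n => F (row_mx (const_mx s : 'rV_1) v)).
have [w0 [w' wE]] : exists w0 w',
    w = row_mx (const_mx w0 : 'rV_1) w' :> 'rV_(1 + n).
  exists (w 0 0), (@rsubmx _ _ 1 n w); rewrite -[LHS](@hsubmxK _ _ 1 n).
  congr row_mx; apply/rowP => j; rewrite !mxE; congr (w _ _).
  by apply/val_inj; rewrite (ord1 j).
have innerE (s : R) :
    C (fun v : 'rV_n => F (row_mx (const_mx s : 'rV_1) v + w)) =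
    G (s + w0).
  rewrite /G -[RHS](IH _ w').
  - congr C; apply/funext => v; congr F; rewrite wE.
    rewrite (_ : const_mx (s + w0) = const_mx s + const_mx w0 :> 'rV_1).
      exact: (@add_row_mx R 1 1 n (const_mx s) v (const_mx w0) w').
    by apply/rowP => j; rewrite !mxE.
  - exact: row_mx_continuousr.
  - move=> j u; rewrite -[RHS](pF (rshift 1 j)); congr F.
    exact: (row_mx_add_deltar (s + w0) u j).
under eq_Rintegral do rewrite innerE.
apply: periodic_Rintegral_translate.
  by apply: normalized_mean_continuous => //; exact: cube_integral_mean.
move=> s; congr C; apply/funext => v.
rewrite -[RHS](pF (lshift n (0 : 'I_1))); congr F.
exact: (row_mx_add_deltal s v).
Qed.

End cube_integral.

(** * Partial derivatives: mean values, locally uniform difference quotients, symmetry of second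
    derivatives *)

Section directional.
Context {R : realType} {d : nat}.
Implicit Types (f g : 'rV[R]_d -> R) (x c : 'rV[R]_d) (i j : 'I_d).
Local Notation e_ i := (delta_mx 0 i : 'rV[R]_d).

Definition has_partials f := forall i x, derivable f x (e_ i).

Lemma is_derive_line f i x (s : R) : has_partials f ->
  is_derive s 1 (fun r : R => f (r *: e_ i + x)) (partial i f (s *: e_ i + x)).
Proof.
move=> df; have := df i (s *: e_ i + x).
rewrite /partial /derivable => cvgf.
have E : (fun h : R => h^-1 *: (f (h *: e_ i + (s *: e_ i + x)) -
      f (s *: e_ i + x))) =
    (fun h : R => h^-1 *: (((fun r : R => f (r *: e_ i + x)) \o shift s)
      (h *: 1) - f (s *: e_ i + x))).
  apply/funext => h /=; congr (_ *: (f _ - _)).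
  by rewrite [h%:A]mulr1 scalerDl addrA.
by apply: DeriveDef; [rewrite /derivable -E|rewrite /derive -E].
Qed.

Lemma partial_MVT f i x (s : R) : has_partials f ->
  exists2 r : R, `|r| <= `|s| &
    f (s *: e_ i + x) - f x = partial i f (r *: e_ i + x) * s.
Proof.
move=> df.
have dl r := is_derive_line i x r df.
have cl (a b : R) :
    {within `[a, b], continuous (fun r : R => f (r *: e_ i + x))}.
  by apply: derivable_within_continuous => r _; have [] := dl r.
have [s0|/ltW s0] := leP 0 s.
  have [r] := MVT_segment s0 (fun r _ => dl r) (cl 0 s).
  rewrite in_itv/= scale0r add0r subr0 => /andP[r0 rs] ->.
  by exists r => //; rewrite !ger0_norm.
have [r] := MVT_segment s0 (fun r _ => dl r) (cl s 0).
rewrite in_itv/= scale0r add0r => /andP[sr r0] E.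
exists r; first by rewrite !ler0_norm// lerN2.
by rewrite -opprB E sub0r mulrN opprK.
Qed.

Lemma partial_translate f i c x :
  partial i (fun y => f (c + y)) x = partial i f (c + x).
Proof.
suff E : (fun h : R => h^-1 *: (f (c + (h *: e_ i + x)) - f (c + x))) =
    (fun h : R => h^-1 *: (f (h *: e_ i + (c + x)) - f (c + x))).
  by rewrite /partial /derive/= E.
by apply/funext => h; rewrite addrCA.
Qed.

Lemma derivable_translate f c x (v : 'rV[R]_d) :
  derivable f (c + x) v -> derivable (fun y => f (c + y)) x v.
Proof.
suff E : (fun h : R => h^-1 *: (f (h *: v + (c + x)) - f (c + x))) =
    (fun h : R => h^-1 *: (f (c + (h *: v + x)) - f (c + x))).
  by rewrite /derivable/= E.
by apply/funext => h; rewrite addrCA.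
Qed.

Lemma cvg_line (T : Type) (F : set_system T) {FF : Filter F} (a : T -> R)
    (y : T -> 'rV[R]_d) (r : R) x (v : 'rV[R]_d) :
  a @ F --> r -> y @ F --> x -> a s *: v + y s @[s --> F] --> r *: v + x.
Proof.
by move=> ar yx; apply: cvgD => //; apply: cvgZ => //; exact: cvg_cst.
Qed.

(** By the mean value theorem the quotient is a value of [partial i f] at distance controlled by the
    increment, so continuity of [partial i f] gives convergence jointly in the base point and the
    increment. *)
Lemma partial_quotient_cvg f i x :
  has_partials f -> continuous (partial i f) ->
  p.2^-1 * (f (p.2 *: e_ i + p.1) - f p.1)
    @[p --> filter_prod (nbhs x) (0 : R)^'] --> partial i f x.
Proof.
move=> df cdf; apply/cvgrPdist_le => e e0.
(* The neighbourhoods of [0] are not punctured here, since the intermediate increment may vanish. *)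
have cj : partial i f (p.2 *: e_ i + p.1)
    @[p --> filter_prod (nbhs x) (nbhs (0 : R))] --> partial i f x.
  rewrite -{2}[x]add0r -(scale0r (e_ i)).
  apply: (cvg_comp (fun p : 'rV[R]_d * R => p.2 *: e_ i + p.1) _ _ (cdf _)).
  apply: (@cvg_line _ _ _ snd fst); first exact: cvg_snd.
  exact: cvg_fst.
have /cvgrPdist_le/(_ e e0) [[A B] /= [Ax B0] AB] := cj.
have /nbhs_ballP[r /= r0 rB] := B0.
exists (A, [set s : R | s != 0 /\ `|s| < r]) => /=.
  split => //; exists r => // s /=; rewrite sub0r normrN => sr s0; split => //.
move=> [y s] /= [Ay [s0 sr]].
have [a as_ ->] := partial_MVT i y s df.
rewrite mulrC mulfK//; apply: (AB (y, a)); split => //=; apply: rB.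
by rewrite -ball_normE/= sub0r normrN (le_lt_trans as_).
Qed.

(** The mean value theorem is used twice: in direction [j] for the increment
    [y |-> f (s *: e_ i + y) - f y], then in direction [i] for [partial j f]. *)
Lemma second_difference f i j x (s r : R) :
  has_partials f -> has_partials (partial j f) ->
  exists2 a : R * R, `|a.1| <= `|s| /\ `|a.2| <= `|r| &
    f (s *: e_ i + (r *: e_ j + x)) - f (r *: e_ j + x)
      - (f (s *: e_ i + x) - f x) =
    partial i (partial j f) (a.1 *: e_ i + (a.2 *: e_ j + x)) * s * r.
Proof.
move=> df ddf.
pose g y := f (s *: e_ i + y) - f y.
have dg : has_partials g.
  move=> k y; apply: derivableB => //; exact: derivable_translate.
have [b br gE] := partial_MVT j x r dg.
have {}gE : g (r *: e_ j + x) - g x = (partial j f (s *: e_ i + (b *: e_ j + x))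
    - partial j f (b *: e_ j + x)) * r.
  rewrite gE; congr (_ * r).
  rewrite -(partial_translate f j (s *: e_ i)) /partial /g.
  by rewrite [LHS]deriveB//; exact: derivable_translate.
have [a as_ aE] := partial_MVT i (b *: e_ j + x) s ddf.
by exists (a, b) => //=; rewrite -aE -gE.
Qed.

(** Schwarz's theorem. The second difference is symmetric in the two directions, so the two mixed
    derivatives take a common value [u] at two points near [x]; by continuity each is within [e / 2]
    of [u] at [x]. *)
Lemma partialC f i j x : has_partials f ->
  has_partials (partial i f) -> has_partials (partial j f) ->
  continuous (partial i (partial j f)) ->
  continuous (partial j (partial i f)) ->
  partial i (partial j f) x = partial j (partial i f) x.
Proof.
move=> df dif djf cij cji; apply/eqP; rewrite -subr_eq0 -normr_le0.
apply/ler_addgt0Pl => e e0; rewrite addr0.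
have cj (g : 'rV[R]_d -> R) (k l : 'I_d) : continuous g ->
    g (p.1 *: e_ k + (p.2 *: e_ l + x))
      @[p --> filter_prod (nbhs (0 : R)) (nbhs (0 : R))] --> g x.
  move=> cg.
  have xE : x = 0 *: e_ k + (0 *: e_ l + x) by rewrite !scale0r !add0r.
  rewrite {2}xE.
  apply: (cvg_comp (fun p : R * R => p.1 *: e_ k + (p.2 *: e_ l + x))
    _ _ (cg _)).
  apply: (@cvg_line _ _ _ fst); first exact: cvg_fst.
  apply: (@cvg_line _ _ _ snd (fun=> x)); first exact: cvg_snd.
  exact: cvg_cst.
have e20 : 0 < e / 2 by rewrite divr_gt0.
have unif (g : 'rV[R]_d -> R) (k l : 'I_d) : continuous g ->
    exists2 r : R, 0 < r & forall a : R * R, `|a.1| <= r -> `|a.2| <= r ->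
      `|g x - g (a.1 *: e_ k + (a.2 *: e_ l + x))| <= e / 2.
  move=> /(cj g k l) /cvgrPdist_le/(_ _ e20) [[A B] /= [A0 B0] AB].
  have /nbhs_ballP[r /= r0 rA] := A0; have /nbhs_ballP[r' /= r'0 rB] := B0.
  (* The radius is halved because the bounds on [a] are large inequalities while the balls are
     open. *)
  exists (Num.min r r' / 2); first by rewrite divr_gt0// lt_min r0.
  have m0 : 0 < Num.min r r' by rewrite lt_min r0.
  have mr : Num.min r r' <= r by rewrite ge_min lexx.
  have mr' : Num.min r r' <= r' by rewrite ge_min lexx orbT.
  move=> [a b] /= ha hb; apply: (AB (a, b)); split => /=.
    apply: rA; rewrite -ball_normE/= sub0r normrN; lra.
  apply: rB; rewrite -ball_normE/= sub0r normrN; lra.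
have [r r0 rP] := unif _ i j cij; have [r' r'0 r'P] := unif _ j i cji.
pose s := Num.min r r'.
have s0 : 0 < s by rewrite lt_min r0.
have sr : s <= r by rewrite ge_min lexx.
have sr' : s <= r' by rewrite ge_min lexx orbT.
have [a [a1 a2] E] := second_difference i x s s df djf.
have [b [b1 b2] E'] := second_difference j x s s df dif.
rewrite (gtr0_norm s0) in a1 a2 b1 b2.
(* Both sides, multiplied by [s * s], are the same second difference with its terms reordered. *)
have {E E'} EE : partial i (partial j f) (a.1 *: e_ i + (a.2 *: e_ j + x)) =
    partial j (partial i f) (b.1 *: e_ j + (b.2 *: e_ i + x)).
  apply: (mulIf (lt0r_neq0 s0)); apply: (mulIf (lt0r_neq0 s0)).
  apply: (etrans (esym E)); apply: etrans E'.
  have swap (p q u v : R) : p - q - (u - v) = p - u - (q - v) by ring.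
  by rewrite (addrCA (s *: e_ i) (s *: e_ j) x); exact: swap.
have hA := rP a (le_trans a1 sr) (le_trans a2 sr).
have hB := r'P b (le_trans b1 sr') (le_trans b2 sr').
rewrite EE in hA.
move: (partial j (partial i f) (b.1 *: _ + _)) hA hB => u hA hB.
have subE (p q v : R) : p - q = (p - v) - (q - v) by ring.
rewrite (subE _ _ u) (splitr e).
exact: le_trans (ler_normB _ _) (lerD hA hB).
Qed.

End directional.

(** * The integral over the torus: limits, translation invariance, integrals of derivatives *)

Section torus_integral.
Context {R : realType} {d : nat} (P : 'M[R]_d).
Implicit Types (f g : 'rV[R]_d -> R) (x : 'rV[R]_d).
Local Notation J := (torus_integral P).

Lemma continuous_mulmx f :
  continuous f -> continuous (fun u : 'rV[R]_d => f (u *m P)).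
Proof.
by move=> cf u; exact: (cvg_comp _ _ (@mulmx_continuous _ _ _ P u) (cf _)).
Qed.

Lemma torus_integral_linear (a : R) f g : continuous f -> continuous g ->
  J (fun x => a * f x + g x) = a * J f + J g.
Proof.
move=> cf cg; have [linC _ _] := @cube_integral_mean R d.
rewrite /torus_integral (linC a (fun u => f (u *m P)) (fun u => g (u *m P))).
- by rewrite mulrDr mulrCA.
- exact: continuous_mulmx.
- exact: continuous_mulmx.
Qed.

Lemma torus_integral_scale (a : R) f : continuous f ->
  J (fun x => a * f x) = a * J f.
Proof.
move=> cf.
have c0 : continuous (fun _ : 'rV[R]_d => 0 : R) by exact: cst_continuous.
have J0 : J (fun=> 0) = 0.
  have -> : (fun _ : 'rV[R]_d => 0 : R) = (fun x => (-1) * 0 + 0).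
    by apply/funext => x; rewrite mulr0 addr0.
  by rewrite torus_integral_linear// mulN1r addNr.
rewrite -[RHS]addr0 -{1}J0 -torus_integral_linear//.
by congr J; apply/funext => x; rewrite addr0.
Qed.

Lemma torus_integral_ge0 f : continuous f -> (forall x, 0 <= f x) -> 0 <= J f.
Proof.
move=> cf f0; have [_ posC _] := @cube_integral_mean R d.
by rewrite mulr_ge0//; apply: posC => //; exact: continuous_mulmx.
Qed.

Lemma torus_integral_cvg (X : Type) (F : set_system X) {FF : Filter F}
    (Phi : X -> 'rV[R]_d -> R) (k : 'rV[R]_d -> R) :
  (\forall s \near F, continuous (Phi s)) -> continuous k ->
  (forall x, Phi p.2 p.1 @[p --> filter_prod (nbhs x) F] --> k x) ->
  J (Phi s) @[s --> F] --> J k.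
Proof.
move=> cPhi ck Phik; apply: cvgMl_tmp.
apply: (normalized_mean_cvg (@cube_integral_mean R d)).
- by apply: filterS cPhi => s; exact: continuous_mulmx.
- exact: continuous_mulmx.
- move=> u _.
  apply: (cvg_comp (fun p : 'rV[R]_d * X => (p.1 *m P, p.2))
    (fun p : 'rV[R]_d * X => Phi p.2 p.1) _ (Phik (u *m P))).
  apply: (@cvg_pair _ _ _ _ (nbhs (u *m P)) F); last exact: cvg_snd.
  apply: (cvg_comp fst (fun u : 'rV[R]_d => u *m P) cvg_fst).
  exact: mulmx_continuous.
Qed.

Hypothesis unitP : P \in unitmx.

(** In the coordinates of the cell, translation by [w] becomes translation by [w *m invmx P], and
    the lattice periods become the standard basis vectors. *)
Lemma torus_integral_translate f (w : 'rV[R]_d) :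
  continuous f -> lattice_periodic P f -> J (fun x => f (w + x)) = J f.
Proof.
move=> cf pf; congr (_ * _).
rewrite -[RHS](@cube_integral_translate _ _ _ (w *m invmx P)).
- congr cube_integral; apply/funext => u.
  by rewrite mulmxDl mulmxKV// addrC.
- exact: continuous_mulmx.
- by move=> j u; rewrite mulmxDl -rowE pf.
Qed.

(** Every difference quotient of [f] has integral zero by translation invariance, and its integral
    converges to that of [partial i f]. *)
Lemma torus_integral_partial f (i : 'I_d) : continuous f -> has_partials f ->
  continuous (partial i f) -> lattice_periodic P f -> J (partial i f) = 0.
Proof.
move=> cf df cdf pf.
have cs (s : R) : continuous (fun x => f (s *: delta_mx 0 i + x)).
  move=> x; apply: (cvg_comp (fun x => s *: delta_mx 0 i + x) f _ (cf _)).
  exact: (@cvgD _ _ _ (nbhs x) _ (cst _) id _ _ (cvg_cst _) cvg_id).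
pose Phi (s : R) x := s^-1 * (f (s *: delta_mx 0 i + x) - f x).
have PhiE s : Phi s =
    (fun x => s^-1 * f (s *: delta_mx 0 i + x) + (- s^-1) * f x).
  by apply/funext => x; rewrite mulNr -mulrBr.
have cM (a : R) g : continuous g -> continuous (fun x => a * g x).
  by move=> cg; apply: continuous_mul => //; exact: cst_continuous.
have JPhi s : J (Phi s) = 0.
  rewrite PhiE torus_integral_linear//; last exact: cM.
  by rewrite torus_integral_scale// torus_integral_translate// mulNr subrr.
have lim1 : J (Phi s) @[s --> (0 : R)^'] --> J (partial i f).
  apply: torus_integral_cvg => //.
    apply: nearW => s; rewrite PhiE; by apply: continuous_add; exact: cM.
  by move=> x; exact: partial_quotient_cvg.
have lim0 : J (Phi s) @[s --> (0 : R)^'] --> (0 : R).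
  by under eq_cvg do rewrite JPhi; exact: cvg_cst.
by apply: (cvg_unique _ lim1 lim0); exact: Rhausdorff.
Qed.

End torus_integral.

(** * The algebra of smooth periodic functions of the space variable *)

Section torus_smooth.
Context {R : realType} {d : nat} (P : 'M[R]_d).
Implicit Types (f g h : 'rV[R]_d -> R) (x : 'rV[R]_d) (i j : 'I_d).

(** Continuity is demanded at every order, because derivability along the basis vectors alone does
    not imply it. *)
Fixpoint Csp (k : nat) f : Prop :=
  continuous f /\
  match k with
  | 0%N => True
  | m.+1 => has_partials f /\ forall i, Csp m (partial i f)
  end.

Lemma CspW k f : Csp k.+1 f -> Csp k f.
Proof.
elim: k f => [|k IH] f [cf [df dpf]]; first by split.
by split => //; split => // i; exact: IH.
Qed.

Lemma partial_add f g i : has_partials f -> has_partials g ->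
  partial i (fun x => f x + g x) = (fun x => partial i f x + partial i g x).
Proof. by move=> df dg; apply/funext => x; rewrite /partial [LHS]deriveD. Qed.

Lemma partial_sub f g i : has_partials f -> has_partials g ->
  partial i (fun x => f x - g x) = (fun x => partial i f x - partial i g x).
Proof. by move=> df dg; apply/funext => x; rewrite /partial [LHS]deriveB. Qed.

Lemma partial_mul f g i : has_partials f -> has_partials g ->
  partial i (fun x => f x * g x) =
  (fun x => partial i f x * g x + f x * partial i g x).
Proof.
move=> df dg; apply/funext => x; rewrite /partial [LHS]deriveM// addrC.
by rewrite /GRing.scale/= mulrC.
Qed.

Lemma partial_cst (a : R) i : partial i (fun=> a) = (fun=> 0).
Proof. by apply/funext => x; rewrite /partial [LHS]derive_cst. Qed.

Lemma Csp_cst k (a : R) : Csp k (fun=> a).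
Proof.
elim: k a => [|k IH] a; split => //; try exact: cst_continuous.
by split => [i x|i]; [exact: derivable_cst|rewrite partial_cst].
Qed.

Lemma Csp_add k f g : Csp k f -> Csp k g -> Csp k (fun x => f x + g x).
Proof.
elim: k f g => [|k IH] f g [cf df] [cg dg];
  split => //; try exact: continuous_add.
case: df dg => [df dpf] [dg dpg]; split => [i x|i]; first exact: derivableD.
by rewrite partial_add//; apply: IH; [exact: dpf|exact: dpg].
Qed.

Lemma Csp_mul k f g : Csp k f -> Csp k g -> Csp k (fun x => f x * g x).
Proof.
elim: k f g => [|k IH] f g sf sg.
  by case: sf sg => [cf _] [cg _]; split => //; exact: continuous_mul.
(* The product rule leaves one factor undifferentiated, which must be taken at the lower order. *)
have sf' := CspW sf; have sg' := CspW sg.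
case: sf sg => [cf [df dpf]] [cg [dg dpg]].
split; first exact: continuous_mul.
split => [i x|i]; first exact: derivableM.
rewrite partial_mul//; apply: Csp_add; apply: IH => //; [exact: dpf|exact: dpg].
Qed.

Definition torus_smooth f := (forall k, Csp k f) /\ lattice_periodic P f.

Lemma torus_smooth_continuous f : torus_smooth f -> continuous f.
Proof. by move=> [/(_ 0%N)[]]. Qed.

Lemma torus_smooth_has_partials f : torus_smooth f -> has_partials f.
Proof. by move=> [/(_ 1%N)[_ []]]. Qed.

Lemma torus_smooth_periodic f : torus_smooth f -> lattice_periodic P f.
Proof. by case. Qed.

Lemma torus_smooth_cst (a : R) : torus_smooth (fun=> a).
Proof. by split => // k; exact: Csp_cst. Qed.

Lemma torus_smooth_add f g : torus_smooth f -> torus_smooth g ->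
  torus_smooth (fun x => f x + g x).
Proof.
move=> [sf pf] [sg pg]; split => [k|i x]; first exact: Csp_add.
by rewrite pf pg.
Qed.

Lemma torus_smooth_mul f g : torus_smooth f -> torus_smooth g ->
  torus_smooth (fun x => f x * g x).
Proof.
move=> [sf pf] [sg pg]; split => [k|i x]; first exact: Csp_mul.
by rewrite pf pg.
Qed.

Lemma torus_smooth_partial f i : torus_smooth f -> torus_smooth (partial i f).
Proof.
move=> [sf pf]; split => [k|j x]; first by have [_ [_ ]] := sf k.+1; exact.
rewrite addrC -partial_translate; congr (partial i _ x).
by apply/funext => y; rewrite addrC pf.
Qed.

Lemma torus_smooth_opp f : torus_smooth f -> torus_smooth (fun x => - f x).
Proof.
move=> sf; have -> : (fun x => - f x) = (fun x => (-1) * f x).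
  by apply/funext => x; rewrite mulN1r.
by apply: torus_smooth_mul => //; exact: torus_smooth_cst.
Qed.

Lemma torus_smooth_sum (I : Type) (r : seq I) (F : I -> 'rV[R]_d -> R) :
  (forall k, torus_smooth (F k)) -> torus_smooth (fun x => \sum_(k <- r) F k x).
Proof.
move=> sF; elim: r => [|k r IH].
  by under eq_fun do rewrite big_nil; exact: torus_smooth_cst.
by under eq_fun do rewrite big_cons; exact: torus_smooth_add.
Qed.

Lemma torus_smooth_partialC f i j : torus_smooth f ->
  partial i (partial j f) = partial j (partial i f).
Proof.
move=> sf; apply/funext => x.
by apply: partialC; (apply: torus_smooth_has_partials ||
  apply: torus_smooth_continuous); do ?[exact: sf|apply: torus_smooth_partial].
Qed.

End torus_smooth.

(** * Integration by parts on the torus and the dissipation inequalities at a fixed time *)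

Section energy.
Context {R : realType} {d : nat} (P : 'M[R]_d).
Hypothesis unitP : P \in unitmx.
Implicit Types (f g h : 'rV[R]_d -> R) (x : 'rV[R]_d) (i j : 'I_d).
Local Notation J := (torus_integral P).
Local Notation smooth := (torus_smooth P).

(* Unfolding these during unification of unequal terms is prohibitively slow. *)
Local Opaque partial torus_smooth torus_integral.

Ltac torus_smooth_tac := repeat first
  [ assumption | apply: torus_smooth_partial | apply: torus_smooth_cst
  | apply: torus_smooth_add | apply: torus_smooth_opp | apply: torus_smooth_mul
  | apply: torus_smooth_sum => ? ].

Lemma torus_integralZ (a : R) f : smooth f -> J (fun x => a * f x) = a * J f.
Proof.
by move=> /torus_smooth_continuous; exact: torus_integral_scale.
Qed.

Lemma torus_integralD f g : smooth f -> smooth g ->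
  J (fun x => f x + g x) = J f + J g.
Proof.
move=> /torus_smooth_continuous cf /torus_smooth_continuous cg.
rewrite -[J f]mul1r -torus_integral_linear//.
by congr J; apply/funext => x; rewrite mul1r.
Qed.

Lemma torus_integral_sum (I : Type) (r : seq I) (F : I -> 'rV[R]_d -> R) :
  (forall k, smooth (F k)) ->
  J (fun x => \sum_(k <- r) F k x) = \sum_(k <- r) J (F k).
Proof.
move=> sF; elim: r => [|k r IH].
  rewrite big_nil; under eq_fun do rewrite big_nil.
  have := torus_integralZ 0 (torus_smooth_cst P 0).
  by rewrite !mul0r.
rewrite big_cons -IH; under eq_fun do rewrite big_cons.
by rewrite torus_integralD//; exact: torus_smooth_sum.
Qed.

Lemma torus_integral_smooth_ge0 f :
  smooth f -> (forall x, 0 <= f x) -> 0 <= J f.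
Proof. by move=> /torus_smooth_continuous; exact: torus_integral_ge0. Qed.

Lemma torus_integral_by_parts f g i : smooth f -> smooth g ->
  J (fun x => partial i f x * g x) = - J (fun x => f x * partial i g x).
Proof.
move=> sf sg; have sfg : smooth (fun x => f x * g x) by torus_smooth_tac.
apply/eqP; rewrite -addr_eq0 -torus_integralD; [|by torus_smooth_tac..].
rewrite -partial_mul;
  [|exact: torus_smooth_has_partials sf|exact: torus_smooth_has_partials sg].
apply/eqP/torus_integral_partial => //.
- exact: torus_smooth_continuous sfg.
- exact: torus_smooth_has_partials sfg.
- exact: torus_smooth_continuous (torus_smooth_partial i sfg).
- exact: torus_smooth_periodic.
Qed.

Lemma torus_integral_mul_div f (V : 'I_d -> 'rV[R]_d -> R) :
  smooth f -> (forall i, smooth (V i)) ->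
  J (fun x => f x * \sum_i partial i (V i) x) =
  - \sum_i J (fun x => partial i f x * V i x).
Proof.
move=> sf sV; under eq_fun do rewrite mulr_sumr.
rewrite torus_integral_sum; last by move=> i; torus_smooth_tac; exact: sV.
rewrite -sumrN; apply: eq_bigr => i _.
by rewrite torus_integral_by_parts// opprK.
Qed.

Lemma laplacianE f : laplacian f = (fun x => \sum_i partial i (partial i f) x).
Proof.
apply/funext => x; apply: eq_bigr => i _; congr (partial i _ x).
by apply/funext => y; rewrite mxE.
Qed.

Lemma torus_smooth_laplacian f : smooth f -> smooth (laplacian f).
Proof. by move=> sf; rewrite laplacianE; torus_smooth_tac. Qed.

(* With [a], [b], [c] the integrals of [h_i h_j h_ij], [h h_ij^2] and
   [h h_ii h_jj], integrating by parts twice gives [a + b] for the left-hand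
   integral, while expanding the derivative gives [c - 2 a]. *)
Lemma hessian_identity h i j : smooth h ->
  3 * J (fun x => partial j (partial j h) x
                  * partial i (fun y => h y * partial i h y) x) =
  2 * J (fun x => h x * partial i (partial j h) x ^+ 2) +
  J (fun x => h x * (partial i (partial i h) x * partial j (partial j h) x)).
Proof.
move=> sh.
have dh := torus_smooth_has_partials sh.
have dp k : has_partials (partial k h).
  by apply: (@torus_smooth_has_partials _ _ P); torus_smooth_tac.
pose w k := fun y => h y * partial k h y.
have sw k : smooth (w k) by rewrite /w; torus_smooth_tac.
have HC := torus_smooth_partialC j i sh.
pose X := J (fun x => partial j (partial j h) x * partial i (w i) x).
pose a := J (fun x => partial i h x * partial j h x * partial i (partial j h) x).
pose b := J (fun x => h x * partial i (partial j h) x ^+ 2).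
pose c := J (fun x =>
  h x * (partial i (partial i h) x * partial j (partial j h) x)).
have X1 : X = a + b.
  have -> : X = - J (fun x => partial i (partial j (partial j h)) x * w i x).
    have sjj := torus_smooth_partial j (torus_smooth_partial j sh).
    by rewrite (torus_integral_by_parts i sjj (sw i)) opprK.
  (* Exchanging the two outer derivatives lets the second integration by parts carry [partial j]
     onto [w i]. *)
  rewrite (torus_smooth_partialC i j (torus_smooth_partial j sh)).
  have sij := torus_smooth_partial i (torus_smooth_partial j sh).
  rewrite (torus_integral_by_parts j sij (sw i)) opprK.
  rewrite /a /b -torus_integralD; [|by torus_smooth_tac|]; last first.
    by under eq_fun do rewrite expr2; torus_smooth_tac.
  congr J; apply/funext => x; rewrite /w (partial_mul j dh (dp i)) HC.
  move: (partial i (partial j h) x) (partial i h x) (partial j h x) (h x).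
  by move=> *; ring.
have X2 : X = -2 * a + c.
  have -> : X = J (fun x =>
      partial j (partial j h) x * (partial i h x * partial i h x)
      + h x * (partial i (partial i h) x * partial j (partial j h) x)).
    congr J; apply/funext => x; rewrite /w (partial_mul i dh (dp i)).
    move: (partial i (partial i h) x) (partial j (partial j h) x).
    by move: (partial i h x) (h x) => *; ring.
  rewrite torus_integralD; [|by torus_smooth_tac..]; congr (_ + c).
  rewrite torus_integral_by_parts; [|by torus_smooth_tac..].
  rewrite mulNr; congr (- _).
  rewrite /a -torus_integralZ; last by torus_smooth_tac.
  congr J; apply/funext => x; rewrite (partial_mul j (dp i) (dp i)) HC.
  move: (partial i (partial j h) x) (partial i h x) (partial j h x).
  by move=> *; ring.
have solve (u v p q : R) : u = p + q -> u = -2 * p + v -> 3 * u = 2 * q + v.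
  by lra.
exact: solve X1 X2.
Qed.

(** Three times this integral is the sum of [hessian_identity] over all pairs [(i, j)], in which the
    products of pure second derivatives recombine into the square of the Laplacian. *)
Lemma laplacian_div_ge0 h : smooth h -> (forall x, 0 <= h x) ->
  0 <= J (fun x => laplacian h x
                   * \sum_i partial i (fun y => h y * partial i h y) x).
Proof.
move=> sh h0; rewrite -(pmulr_rge0 _ (ltr0n R 3)).
have -> : 3 * J (fun x => laplacian h x
      * \sum_i partial i (fun y => h y * partial i h y) x) =
    \sum_j \sum_i 2 * J (fun x => h x * partial i (partial j h) x ^+ 2)
    + J (fun x => h x * laplacian h x ^+ 2).
  have -> : J (fun x => h x * laplacian h x ^+ 2) = \sum_j \sum_i
     J (fun x => h x * (partial i (partial i h) x * partial j (partial j h) x)).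
    transitivity (J (fun x => \sum_j \sum_i
      h x * (partial i (partial i h) x * partial j (partial j h) x))).
      congr J; apply/funext => x; rewrite laplacianE expr2 mulr_sumr mulr_sumr.
      by apply: eq_bigr => j _; rewrite mulr_suml mulr_sumr.
    rewrite torus_integral_sum; last by move=> j; torus_smooth_tac.
    apply: eq_bigr => j _.
    by rewrite torus_integral_sum// => i; torus_smooth_tac.
  rewrite -big_split/=; under [RHS]eq_bigr do rewrite -big_split/=.
  under [RHS]eq_bigr => j _ do
    under eq_bigr => i _ do rewrite -hessian_identity//.
  transitivity (3 * J (fun x => \sum_j \sum_i partial j (partial j h) x
      * partial i (fun y => h y * partial i h y) x)).
    congr (_ * J _); apply/funext => x; rewrite laplacianE mulr_suml.
    by apply: eq_bigr => j _; rewrite mulr_sumr.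
  rewrite torus_integral_sum; last by move=> j; torus_smooth_tac.
  rewrite mulr_sumr; apply: eq_bigr => j _.
  rewrite torus_integral_sum; last by move=> i; torus_smooth_tac.
  by rewrite mulr_sumr.
have sL := torus_smooth_laplacian sh.
apply: addr_ge0; last first.
  apply: torus_integral_smooth_ge0 => [|x]; last by rewrite mulr_ge0// sqr_ge0.
  by under eq_fun do rewrite expr2; torus_smooth_tac.
apply: sumr_ge0 => j _; apply: sumr_ge0 => i _; apply: mulr_ge0 => //.
apply: torus_integral_smooth_ge0 => [|x]; last by rewrite mulr_ge0// sqr_ge0.
by under eq_fun do rewrite expr2; torus_smooth_tac.
Qed.

(** Coordinates of the vector field whose divergence is the time derivative of [h] in the
    equation. *)
Definition flux (g mu : R) h (i : 'I_d) x : R :=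
  g * (h x * partial i h x) - mu * (h x * partial i (laplacian h) x).

Lemma torus_smooth_flux (g mu : R) h i : smooth h -> smooth (flux g mu h i).
Proof.
move=> sh; have sL := torus_smooth_laplacian sh.
by rewrite /flux; torus_smooth_tac.
Qed.

(** This cross term occurs in both energy balances, with coefficient [mu] for the square and [g] for
    the gradient, so one positivity result serves both. *)
Lemma sum_laplacian_by_parts h : smooth h ->
  \sum_i J (fun x => h x * partial i h x * partial i (laplacian h) x) =
  - J (fun x => laplacian h x
                * \sum_i partial i (fun y => h y * partial i h y) x).
Proof.
move=> sh; have sL := torus_smooth_laplacian sh.
rewrite (torus_integral_mul_div (V := fun i y => h y * partial i h y))//;
  last first.
  by move=> i; torus_smooth_tac.
rewrite opprK; apply: eq_bigr => i _; congr J; apply/funext => x.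
by rewrite mulrC.
Qed.

Lemma sqr_dissipation (g mu : R) h : 0 <= g -> 0 <= mu -> smooth h ->
  (forall x, 0 <= h x) ->
  J (fun x => h x * \sum_i partial i (flux g mu h i) x) <= 0.
Proof.
move=> g0 mu0 sh h0; have sL := torus_smooth_laplacian sh.
rewrite (torus_integral_mul_div sh (fun i => torus_smooth_flux g mu i sh)).
rewrite oppr_le0.
have -> : \sum_i J (fun x => partial i h x * flux g mu h i x) =
    g * \sum_i J (fun x => h x * (partial i h x * partial i h x)) +
    (- mu) * \sum_i J (fun x => h x * partial i h x * partial i (laplacian h) x).
  rewrite !mulr_sumr -big_split/=; apply: eq_bigr => i _.
  rewrite -!torus_integralZ; try by torus_smooth_tac.
  rewrite -torus_integralD; try by torus_smooth_tac.
  congr J; apply/funext => x; rewrite /flux.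
  move: (h x) (partial i h x) (partial i (laplacian h) x).
  by move=> *; ring.
rewrite (sum_laplacian_by_parts sh) mulrNN.
apply: addr_ge0; apply: mulr_ge0 => //.
  apply: sumr_ge0 => i _; apply: torus_integral_smooth_ge0.
    by torus_smooth_tac.
  by move=> x; rewrite mulr_ge0// -expr2 sqr_ge0.
exact: laplacian_div_ge0.
Qed.

(** The equation is tested against the Laplacian rather than its opposite, hence the sign. Compared
    with [sqr_dissipation], [g] and [mu] exchange roles: [g] multiplies the cross term, [mu] a
    weighted integral of squares. *)
Lemma gradient_dissipation (g mu : R) h : 0 <= g -> 0 <= mu -> smooth h ->
  (forall x, 0 <= h x) ->
  0 <= J (fun x => laplacian h x * \sum_i partial i (flux g mu h i) x).
Proof.
move=> g0 mu0 sh h0; have sL := torus_smooth_laplacian sh.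
rewrite (torus_integral_mul_div sL (fun i => torus_smooth_flux g mu i sh)).
have -> : \sum_i J (fun x => partial i (laplacian h) x * flux g mu h i x) =
    g * \sum_i J (fun x => h x * partial i h x * partial i (laplacian h) x) +
    (- mu) * \sum_i J (fun x => h x *
      (partial i (laplacian h) x * partial i (laplacian h) x)).
  rewrite !mulr_sumr -big_split/=; apply: eq_bigr => i _.
  rewrite -!torus_integralZ; try by torus_smooth_tac.
  rewrite -torus_integralD; try by torus_smooth_tac.
  congr J; apply/funext => x; rewrite /flux.
  move: (h x) (partial i h x) (partial i (laplacian h) x).
  by move=> *; ring.
rewrite (sum_laplacian_by_parts sh) mulrN mulNr -opprD opprK.
apply: addr_ge0; apply: mulr_ge0 => //; first exact: laplacian_div_ge0.
apply: sumr_ge0 => i _; apply: torus_integral_smooth_ge0.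
  by torus_smooth_tac.
by move=> x; rewrite mulr_ge0// -expr2 sqr_ge0.
Qed.

(** The difference of squares factors as the scalar product of [grad (f - g)] and [grad (f + g)];
    integrating by parts frees [f - g] from space derivatives, so that for [f] and [g] at two times
    only [h] itself is differentiated in time. *)
Lemma sqnorm_grad_difference f g : smooth f -> smooth g ->
  J (fun x => sqnorm (grad f x)) - J (fun x => sqnorm (grad g x)) =
  - J (fun x => (f x - g x) * (laplacian f x + laplacian g x)).
Proof.
move=> sf sg.
have sLf := torus_smooth_laplacian sf; have sLg := torus_smooth_laplacian sg.
have sqE k : (fun x => sqnorm (grad k x)) =
    (fun x => \sum_i partial i k x * partial i k x).
  by apply/funext => x; apply: eq_bigr => i _; rewrite mxE expr2.
pose u x := f x - g x.
have su : smooth u by rewrite /u; torus_smooth_tac.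
have puE i : partial i u = (fun x => partial i f x - partial i g x).
  by rewrite partial_sub//; exact: (@torus_smooth_has_partials _ _ P).
have -> : (fun x => (f x - g x) * (laplacian f x + laplacian g x)) =
   (fun x => u x * \sum_i partial i (fun y => partial i f y + partial i g y) x).
  apply/funext => x; congr (_ * _); rewrite !laplacianE -big_split/=.
  apply: eq_bigr => i _; rewrite partial_add//;
    by apply: (@torus_smooth_has_partials _ _ P); torus_smooth_tac.
rewrite (torus_integral_mul_div
    (V := fun i y => partial i f y + partial i g y))//;
  last by move=> i; torus_smooth_tac.
rewrite opprK !sqE -mulN1r -torus_integralZ; last by torus_smooth_tac.
rewrite -torus_integralD; [|by torus_smooth_tac..].
rewrite -torus_integral_sum; last by move=> i; torus_smooth_tac.
congr J; apply/funext => x; rewrite mulN1r -sumrN -big_split/=.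
apply: eq_bigr => i _; rewrite puE.
by move: (partial i f x) (partial i g x) => *; ring.
Qed.

End energy.

(** * Derivatives relative to the time interval *)

Section time_derivative.
Context {R : realType}.

(** Properness ensures that [lim] along this filter equals any limit found, at the end points of the
    interval as well. *)
Lemma within_itv_proper (T t : R) : 0 < T -> t \in `[0, T] ->
  ProperFilter (within `[0, T] t^').
Proof.
move=> T0; rewrite in_itv/= => /andP[t0 tT].
apply: Build_ProperFilter_ex => B.
rewrite /within/= => /nbhs_ballP[e /= e0 eB].
have [tT'|Tt] := ltP t T.
  (* The bound [e / 2] keeps [t + m] in the open ball, and [T - t] keeps it in the interval; at
     [t = T] the step is taken to the left. *)
  have m0 : 0 < Num.min (e / 2) (T - t) by rewrite lt_min divr_gt0//= subr_gt0.
  have me : Num.min (e / 2) (T - t) <= e / 2 by rewrite ge_min lexx.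
  have mT : Num.min (e / 2) (T - t) <= T - t by rewrite ge_min lexx orbT.
  set m := Num.min _ _ in m0 me mT.
  exists (t + m); apply: eB => /=.
  - rewrite -ball_normE/= opprD addNKr normrN gtr0_norm//; lra.
  - by rewrite -subr_eq0 addrAC subrr add0r gt_eqF.
  - rewrite in_itv/=; apply/andP; split; lra.
have tE : t = T by apply/eqP; rewrite eq_le tT Tt.
have m0 : 0 < Num.min (e / 2) t by rewrite lt_min divr_gt0//= tE.
have me : Num.min (e / 2) t <= e / 2 by rewrite ge_min lexx.
have mT : Num.min (e / 2) t <= t by rewrite ge_min lexx orbT.
set m := Num.min _ _ in m0 me mT.
exists (t - m); apply: eB => /=.
- rewrite -ball_normE/= opprB addrC subrK gtr0_norm//; lra.
- by rewrite -subr_eq0 addrAC subrr add0r oppr_eq0 gt_eqF.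
- rewrite in_itv/=; apply/andP; split; lra.
Qed.

(** At an interior time the relative derivative is the usual one, which gives access to the mean
    value theorem. *)
Lemma is_derive_within (T t : R) (f : R -> R) : t \in `]0, T[ ->
  derivable_within `[0, T] f t ->
  is_derive t 1 f (derive_within `[0, T] f t).
Proof.
rewrite in_itv/= => /andP[t0 tT]; rewrite /derivable_within => cvgf.
suff lf : h^-1 *: (f (h *: 1 + t) - f t) @[h --> (0 : R)^'] -->
    derive_within `[0, T] f t.
  by apply: DeriveDef; [apply/cvg_ex; eexists; exact: lf|exact: cvg_lim lf].
have E : (fun h : R => h^-1 *: (f (h *: 1 + t) - f t)) =
    quotient_within f t \o (fun h => h + t).
  by apply/funext => h; rewrite /quotient_within/= [h%:A]mulr1 addrK.
rewrite E; apply: (cvg_comp _ _ _ cvgf) => B.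
move=> /nbhs_ballP[e /= e0 eB].
(* Below this radius [h + t] stays in the interval, so the restriction to [[0, T]] is automatic. *)
have m0 : 0 < Num.min e (Num.min t (T - t)) by rewrite !lt_min e0 t0 subr_gt0.
exists (Num.min e (Num.min t (T - t))) => // h /=.
rewrite sub0r normrN !lt_min => /and3P[he ht hT] h0.
apply: eB => /=.
- by rewrite -ball_normE/= opprD addrC subrK normrN.
- by rewrite -subr_eq0 addrK.
- move: ht hT; rewrite !ltr_norml in_itv/= => /andP[? ?] /andP[? ?].
  apply/andP; split; lra.
Qed.

End time_derivative.

(** * Functions of time and space: slices and uniform difference quotients in time *)

Section evolution.
Context {R : realType} {d : nat} (T : R).
Implicit Types (f : R -> 'rV[R]_d -> R).

Lemma within_joint_cvg (X : Type) (F : set_system X) {FF : Filter F} f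
    (a : X -> R) (y : X -> 'rV[R]_d) (t : R) (x : 'rV[R]_d) :
  {within `[0, T] `*` [set: 'rV[R]_d],
    continuous (fun p : R * 'rV[R]_d => f p.1 p.2)} ->
  t \in `[0, T] -> (\forall s \near F, a s \in `[0, T]) ->
  a @ F --> t -> y @ F --> x -> f (a s) (y s) @[s --> F] --> f t x.
Proof.
move=> /subspace_continuousP cf tT aT at_ yx.
have := cf (t, x); rewrite /= => /(_ (conj tT I)) cftx.
apply: (cvg_comp (fun s => (a s, y s))
  (fun p : R * 'rV[R]_d => f p.1 p.2) _ cftx).
move=> B; rewrite /within/= => nB.
have pay : (a s, y s) @[s --> F] --> (t, x) by exact: (cvg_pair at_ yx).
by apply: filterS (filterI aT (pay _ nB)) => s /= [aTs]; apply; split.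
Qed.

Lemma Ck_continuous k f : Ck T k f ->
  {within `[0, T] `*` [set: 'rV[R]_d],
    continuous (fun p : R * 'rV[R]_d => f p.1 p.2)}.
Proof. by case: k => [|k] []. Qed.

Lemma Ck_continuous_slice k f (t : R) :
  t \in `[0, T] -> Ck T k f -> continuous (f t).
Proof.
move=> tT /Ck_continuous cf x.
apply: (@within_joint_cvg _ (nbhs x) _ f (fun=> t) id t x cf tT).
- exact: nearW.
- exact: cvg_cst.
- exact: cvg_id.
Qed.

Lemma Ck_Csp k f (t : R) : t \in `[0, T] -> Ck T k f -> Csp k (f t).
Proof.
move=> tT; elim: k f => [|k IH] f sf; split => //;
  try exact: Ck_continuous_slice tT sf.
case: sf => _ [_ df _ sdf]; split => [i x|i]; first exact: df.
exact: IH (sdf i).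
Qed.

(** The points strictly between [t] and [s] are interior to [[0, T]], where [dtime] is the usual
    derivative; at the end points of the segment continuity suffices. *)
Lemma time_MVT f (t s : R) (x : 'rV[R]_d) :
  {within `[0, T] `*` [set: 'rV[R]_d],
    continuous (fun p : R * 'rV[R]_d => f p.1 p.2)} ->
  (forall r, r \in `[0, T] -> derivable_within `[0, T] (f^~ x) r) ->
  t \in `[0, T] -> s \in `[0, T] ->
  exists r : R, [/\ r \in `[0, T], `|r - t| <= `|s - t| &
    f s x - f t x = dtime T f r x * (s - t)].
Proof.
move=> cf df.
have main (a b : R) : a <= b -> a \in `[0, T] -> b \in `[0, T] ->
    exists2 c, c \in `[a, b] & f b x - f a x = dtime T f c x * (b - a).
  rewrite !in_itv/= => ab /andP[a0 aT] /andP[b0 bT].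
  apply: (@MVT_segment _ (f^~ x) (dtime T f ^~ x) a b ab) => [r|].
    rewrite in_itv/= => /andP[ar rb]; apply: is_derive_within.
      by rewrite in_itv/= (le_lt_trans a0 ar) (lt_le_trans rb bT).
    apply: df.
    by rewrite in_itv/= (le_trans a0 (ltW ar)) (le_trans (ltW rb) bT).
  apply/subspace_continuousP => r /=; rewrite in_itv/= => /andP[ar rb].
  apply: (@within_joint_cvg _ _ _ f id (fun=> x) r x cf).
  - by rewrite in_itv/= (le_trans a0 ar) (le_trans rb bT).
  - rewrite near_withinE; apply: nearW => q /=.
    rewrite !in_itv/= => /andP[aq qb].
    by rewrite (le_trans a0 aq) (le_trans qb bT).
  - exact: cvg_within.
  - exact: cvg_cst.
move=> tT sT.
have itvT (c a b : R) :
    a \in `[0, T] -> b \in `[0, T] -> c \in `[a, b] -> c \in `[0, T].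
  rewrite !in_itv/= => /andP[a0 _] /andP[_ bT] /andP[ac cb].
  by rewrite (le_trans a0 ac) (le_trans cb bT).
have [ts|/ltW st] := leP t s.
  have [c cts E] := main t s ts tT sT; exists c.
  split => //; first exact: itvT cts.
  move: cts; rewrite in_itv/= => /andP[tc cs].
  by rewrite !ger0_norm ?subr_ge0// lerD2r.
have [c cst E] := main s t st sT tT; exists c.
  split => //; first exact: itvT cst.
  move: cst; rewrite in_itv/= => /andP[sc ct].
  by rewrite !ler0_norm ?subr_le0// lerN2 lerD2r.
by rewrite -opprB E -mulrN opprB.
Qed.

(** The counterpart in time of [partial_quotient_cvg]: the quotient is a value of [dtime T f] at an
    intermediate time, and [dtime T f] is jointly continuous. *)
Lemma time_quotient_cvg f (t : R) (x : 'rV[R]_d) : Ck T 1 f -> t \in `[0, T] ->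
  quotient_within (f^~ p.1) t p.2
    @[p --> filter_prod (nbhs x) (within `[0, T] t^')] --> dtime T f t x.
Proof.
move=> [cf [df _ [cdf _] _]] tT; apply/cvgrPdist_le => e e0.
(* The intermediate time may be [t] itself, so these neighbourhoods of [t] are not punctured. *)
have cj : dtime T f p.2 p.1
    @[p --> filter_prod (nbhs x) (within `[0, T] (nbhs t))] --> dtime T f t x.
  apply: (@within_joint_cvg _ _ _ (dtime T f) snd fst t x cdf tT);
    last exact: cvg_fst.
  - exists (setT, [set` `[0, T]]) => /=; last by move=> p [].
    by split; [exact: filterT|apply: nearW].
  - by move=> B nB; apply: cvg_snd; exact: cvg_within nB.
have /cvgrPdist_le/(_ e e0) [[A B] /= [Ax B0] AB] := cj.
have /nbhs_ballP[r /= r0 rB] := B0.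
exists (A, [set s : R | [/\ s != t, s \in `[0, T] & `|s - t| < r]]) => /=.
  split => //; exists r => // s /= str st sT; split => //.
  by rewrite distrC.
move=> [y s] /= [Ay [st sT sr]].
have [q [qT qs E]] := time_MVT cf (fun r => df r y) tT sT.
rewrite /quotient_within E mulrC mulfK ?subr_eq0//.
apply: (AB (y, q)); split => //=; apply: rB => //.
by rewrite -ball_normE/= distrC (le_lt_trans qs).
Qed.

End evolution.

(** * Differentiation of an energy under the integral sign *)

Section energy_derivative.
Context {R : realType} {d : nat} (P : 'M[R]_d) (T : R).
Local Notation J := (torus_integral P).

(** Both energies fit this form, with [w] equal to [h] or to minus its Laplacian. The quotient of
    [h] converges jointly to [dtime T h t] and [w s + w t] to twice [w t]; [w] is never
    differentiated in time. *)
Lemma energy_derivative (E : R -> R) (h w : R -> 'rV[R]_d -> R) (t : R) :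
  0 < T -> t \in `[0, T] -> Ck T 1 h -> Ck T 0 w ->
  (forall s, s \in `[0, T] ->
    E s - E t = J (fun x => (h s x - h t x) * (w s x + w t x))) ->
  derivable_within `[0, T] E t /\
  derive_within `[0, T] E t = 2 * J (fun x => w t x * dtime T h t x).
Proof.
move=> T0 tT sh sw EE.
have proper := within_itv_proper T0 tT.
have ch s : s \in `[0, T] -> continuous (h s).
  by move=> sT; have [] := Ck_Csp sT sh.
have cw s : s \in `[0, T] -> continuous (w s).
  by move=> sT; have [] := Ck_Csp sT sw.
have cdh : continuous (dtime T h t).
  case: sh => _ [_ _ sdh _].
  exact: (@Ck_continuous_slice _ _ T 0 _ t tT sdh).
have cc (a : R) : continuous (fun _ : 'rV[R]_d => a) by exact: cst_continuous.
have nT : \forall s \near within `[0, T] t^', s \in `[0, T] /\ s != t.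
  by rewrite !near_withinE; apply: nearW => s st sT; split.
pose Phi s x := quotient_within (h^~ x) t s * (w s x + w t x).
have lim : J (Phi s) @[s --> within `[0, T] t^'] -->
    J (fun x => dtime T h t x * (w t x + w t x)).
  apply: torus_integral_cvg.
  - apply: filterS nT => s [sT _]; apply: continuous_mul.
      apply: continuous_mul => //; apply: continuous_add; first exact: ch.
      by move=> x; exact: (cvgN (ch t tT x)).
    by apply: continuous_add; exact: cw.
  - by apply: continuous_mul => //; apply: continuous_add; exact: cw.
  - move=> x; apply: cvgM; first exact: time_quotient_cvg.
    apply: cvgD; last first.
      apply: (cvg_comp fst (w t) cvg_fst); exact: cw.
    apply: (@within_joint_cvg _ _ T _ _ _ w snd fst t x (proj1 sw) tT).
    + exists (setT, [set` `[0, T]]) => /=; last by move=> p [].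
      by split; [exact: filterT|apply: filterS nT => s []].
    + by move=> B nB; apply: cvg_snd; apply: cvg_within; exact: cvg_within nB.
    + exact: cvg_fst.
have limE : quotient_within E t @ within `[0, T] t^' -->
    2 * J (fun x => w t x * dtime T h t x).
  have -> : 2 * J (fun x => w t x * dtime T h t x) =
      J (fun x => dtime T h t x * (w t x + w t x)).
    have c1 : continuous (fun x => w t x * dtime T h t x).
      by apply: continuous_mul => //; exact: cw.
    rewrite mulrDl mul1r -[X in X + _]mul1r -torus_integral_linear//.
    by congr J; apply/funext => x; rewrite mul1r mulrDr mulrC.
  apply: cvg_trans lim; apply: near_eq_cvg.
  apply: filterS nT => s [sT st].
  rewrite /quotient_within EE//.
  have cd : continuous (fun x => (h s x - h t x) * (w s x + w t x)).
    apply: continuous_mul; last by apply: continuous_add; exact: cw.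
    apply: continuous_add; first exact: ch.
    by move=> x; exact: (cvgN (ch t tT x)).
  rewrite -torus_integral_scale//; congr J; apply/funext => x.
  by rewrite /Phi /quotient_within mulrA.
split; first by apply/cvg_ex; eexists; exact: limE.
exact: cvg_lim limE.
Qed.

End energy_derivative.

(** * Increments of the square energy and continuity of the Laplacian in time and space *)

Section energy_increments.
Context {R : realType} {d : nat} (P : 'M[R]_d) (T : R).
Local Notation J := (torus_integral P).

Lemma sqr_difference (f g : 'rV[R]_d -> R) :
  torus_smooth P f -> torus_smooth P g ->
  J (fun x => f x ^+ 2) - J (fun x => g x ^+ 2) =
  J (fun x => (f x - g x) * (f x + g x)).
Proof.
move=> sf sg;
have sqE k : (fun x : 'rV[R]_d => k x ^+ 2) = (fun x => k x * k x).
  by apply/funext => x; rewrite expr2.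
have sff := torus_smooth_mul sf sf; have sgg := torus_smooth_mul sg sg.
rewrite !sqE -mulN1r -torus_integralZ// -torus_integralD//; last first.
  by apply: torus_smooth_mul => //; exact: torus_smooth_cst.
by congr J; apply/funext => x; rewrite mulN1r -!expr2 subr_sqr.
Qed.

Lemma Ck_oppr_laplacian (h : R -> 'rV[R]_d -> R) : smooth T h ->
  Ck T 0 (fun s x => - laplacian (h s) x).
Proof.
move=> sh; split => //.
apply/subspace_continuousP => -[t x] tT /=; apply: cvgN.
under eq_cvg do rewrite laplacianE.
rewrite laplacianE; apply: cvg_big => [|i _]; first exact: add_continuous.
(* Two space derivatives are unfolded from the smoothness of order [2] to reach the joint continuity
   of each pure second derivative. *)
have [_ [_ _ _ /(_ i) [_ [_ _ _ /(_ i) [cii _]]]]] := sh 2%N.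
move/subspace_continuousP in cii.
exact: (cii (t, x) tT).
Qed.

End energy_increments.

Theorem theorem2p5 (R : realType) (d : nat) (P : 'M[R]_d) (g mu T : R)
  (h : R -> 'rV[R]_d -> R) :
  (1 <= d)%N ->
  P \in unitmx ->
  0 <= g -> 0 <= mu -> 0 < T ->
  (forall t : R, t \in `[0, T] -> lattice_periodic P (h t)) ->
  smooth T h ->
  (forall (t : R) (x : 'rV[R]_d), t \in `[0, T] -> 0 < h t x) ->
  (forall (t : R) (x : 'rV[R]_d), t \in `[0, T] ->
     dtime T h t x
       - div (fun y => (g * h t y) *: grad (h t) y
                       - (mu * h t y) *: grad (laplacian (h t)) y) x = 0) ->
  forall t : R, t \in `[0, T] ->
    (derivable_within `[0, T]
       (fun s => torus_integral P (fun x => h s x ^+ 2)) t /\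
     derive_within `[0, T]
       (fun s => torus_integral P (fun x => h s x ^+ 2)) t <= 0) /\
    (derivable_within `[0, T]
       (fun s => torus_integral P (fun x => sqnorm (grad (h s) x))) t /\
     derive_within `[0, T]
       (fun s => torus_integral P (fun x => sqnorm (grad (h s) x))) t <= 0).

Proof.
move=> d1 unitP g0 mu0 T0 per sm pos pde t tT.
have sh s : s \in `[0, T] -> torus_smooth P (h s).
  by move=> sT; split; [move=> k; exact: Ck_Csp sT (sm k)|exact: per].
(* The equation is put in the form [dtime T h t = div (flux)], coordinate by coordinate. *)
have pdeE : dtime T h t = (fun x => \sum_i partial i (flux g mu (h t) i) x).
  apply/funext => x; rewrite (subr0_eq (pde t x tT)).
  apply: eq_bigr => i _; congr (partial i _ x).
  by apply/funext => y; rewrite !mxE /flux !mulrA.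
have h0 x : 0 <= h t x by exact: ltW (pos t x tT).
split.
  (* The square energy corresponds to the weight [w = h]. *)
  have [|D ->] := @energy_derivative _ _ P T
    (fun s => torus_integral P (fun x => h s x ^+ 2))
    h h t T0 tT (sm 1%N) (sm 0%N).
    by move=> s sT; apply: sqr_difference; exact: sh.
  split => //; rewrite pmulr_rle0// pdeE.
  by apply: sqr_dissipation => //; exact: sh.
(* For the gradient energy the weight is minus the Laplacian, which takes up the sign in
   [sqnorm_grad_difference]. *)
have [|D ->] := @energy_derivative _ _ P T
  (fun s => torus_integral P (fun x => sqnorm (grad (h s) x))) h
  (fun s x => - laplacian (h s) x) t T0 tT (sm 1%N) (Ck_oppr_laplacian sm).
  move=> s sT; rewrite (sqnorm_grad_difference unitP (sh s sT) (sh t tT)).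
  rewrite -mulN1r -torus_integralZ.
    by congr torus_integral; apply/funext => x; rewrite mulN1r -mulrN opprD.
  apply: torus_smooth_mul; apply: torus_smooth_add.
  - exact: sh.
  - by apply: torus_smooth_opp; exact: sh.
  - exact: torus_smooth_laplacian (sh s sT).
  - exact: torus_smooth_laplacian (sh t tT).
split => //; rewrite pmulr_rle0// pdeE.
have -> : (fun x =>
      - laplacian (h t) x * \sum_i partial i (flux g mu (h t) i) x) =
    (fun x =>
      -1 * (laplacian (h t) x * \sum_i partial i (flux g mu (h t) i) x)).
  by apply/funext => x; rewrite mulN1r mulNr.
rewrite torus_integralZ.
  by rewrite mulN1r oppr_le0; apply: gradient_dissipation => //; exact: sh.
apply: torus_smooth_mul; first exact: torus_smooth_laplacian (sh t tT).
apply: torus_smooth_sum => i; apply: torus_smooth_partial.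
exact: torus_smooth_flux (sh t tT).
Qed.
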